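(* Let $I$ be an instance of SPA-ST and let $J$ be the integer program for $I$ described in the context. If $S$ is a feasible solution to $J$, then $M=\{(s_i,p_j): x_{i,j}=1 \text{ in } S\}$ is a super-stable matching in $I$ with $|M|$ equal to the objective value of $S$. Conversely, if $M$ is a super-stable matching in $I$, then there is a feasible solution $S$ to $J$ with $x_{i,j}=1$ exactly for $(s_i,p_j)\in M$, whose objective value equals $|M|$.
   Context: An instance $I$ of SPA-ST consists of students $s_1,\dots,s_{n_1}$, projects $p_1,\dots,p_{n_2}$ and lecturers $l_1,\dots,l_{n_3}$. Each student $s_i$ has a set $A_i$ of acceptable projects ranked as a strict ranking of ties (a tie is a set of equally preferred entries). Each lecturer $l_k$ offers a non-empty set $P_k$ of projects, the $P_k$ partitioning the projects; $l_k$ has capacity $d_k\in\mathbb{Z}^+$ and a preference list $\mathcal{L}_k$ ranking, as a strict ranking of ties, exactly those students finding some project in $P_k$ acceptable; $\mathcal{L}_k^j$ is $\mathcal{L}_k$ restricted to students finding $p_j$ acceptable. Project $p_j$ has capacity $c_j\in\mathbb{Z}^+$, and $\max\{c_j:p_j\in P_k\}\le d_k\le\sum_{p_j\in P_k}c_j$. A matching is a set $M$ of acceptable pairs with each student in at most one pair, $|M(p_j)|\le c_j$, $|M(l_k)|\le d_k$ ($M(p_j)$: students assigned to $p_j$; $M(l_k)$: students assigned to projects of $P_k$). Undersubscribed/full means fewer than/exactly capacity many assignees. With $l_k$ the lecturer offering $p_j$, $M$ is super-stable if no acceptable pair $(s_i,p_j)\notin M$ satisfies: (a) $s_i$ is unassigned,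 or prefers $p_j$ to $M(s_i)$ or is indifferent between them, and (b) either (i) $p_j$ and $l_k$ are undersubscribed, or (ii) $p_j$ is undersubscribed, $l_k$ is full and either $s_i\in M(l_k)$ or $l_k$ prefers $s_i$ to a worst student in $M(l_k)$ or is indifferent between them, or (iii) $p_j$ is full and $l_k$ prefers $s_i$ to a worst student in $M(p_j)$ or is indifferent between them. Ranks: $\mathrm{rank}(s_i,p_j)=1+$ the number of projects $s_i$ strictly prefers to $p_j$; $\mathrm{rank}(l_k,s_i)=1+$ the number of students $l_k$ strictly prefers to $s_i$. For acceptable $(s_i,p_j)$ with $p_j\in P_k$: $S_{i,j}=\{p_{j'}\in A_i:\mathrm{rank}(s_i,p_{j'})<\mathrm{rank}(s_i,p_j)\}$, $T_{i,j,k}=\{s_{i'}\in\mathcal{L}_k^j:\mathrm{rank}(l_k,s_{i'})<\mathrm{rank}(l_k,s_i)\}$, $D_{i,k}=\{s_{i'}\in\mathcal{L}_k:\mathrm{rank}(l_k,s_{i'})<\mathrm{rank}(l_k,s_i)\}$. (Sums $\sum_{i'}x_{i',j}$ range over students for whom $p_j$ is acceptable.) The IP $J$ has binary variables $x_{i,j}$ for each acceptable pair $(s_i,p_j)$, $\alpha_j,\gamma_j$ for each project, $\beta_k,\eta_k$ for each lecturer, and $\delta_{i,k}$, $\lambda_{i,j,k}$ for each acceptable pair $(s_i,p_j)$ with $p_j\in P_k$. Constraints: $\sum_{p_j\in A_i}x_{i,j}\le 1$ for each $i$; $\sum_{i'}x_{i',j}\le c_j$ for each $j$; $\sum_{i'}\sum_{p_{j'}\in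 P_k}x_{i',j'}\le d_k$ for each $k$; and for every acceptable pair $(s_i,p_j)$ with $p_j\in P_k$, writing $\theta_{i,j}=1-x_{i,j}-\sum_{p_{j'}\in S_{i,j}}x_{i,j'}$: $c_j\alpha_j\ge c_j-\sum_{i'}x_{i',j}$; $d_k\beta_k\ge d_k-\sum_{i'}\sum_{p_{j'}\in P_k}x_{i',j'}$; $\theta_{i,j}+\alpha_j+\beta_k\le 2$; $d_k\eta_k\ge\big(1+\sum_{i'}\sum_{p_{j'}\in P_k}x_{i',j'}\big)-d_k$; $d_k\delta_{i,k}\ge\sum_{i'}\sum_{p_{j'}\in P_k}x_{i',j'}-\sum_{s_{i'}\in D_{i,k}}\sum_{p_{j'}\in P_k}x_{i',j'}$; $\theta_{i,j}+\alpha_j+\eta_k+\delta_{i,k}\le 3$; $c_j\gamma_j\ge\big(1+\sum_{i'}x_{i',j}\big)-c_j$; $c_j\lambda_{i,j,k}\ge\sum_{i'}x_{i',j}-\sum_{s_{i'}\in T_{i,j,k}}x_{i',j}$; $\theta_{i,j}+\gamma_j+\lambda_{i,j,k}\le 2$. Objective: maximise $\sum_{i}\sum_{p_j\in A_i}x_{i,j}$. *)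

(* Defs.v *)
From mathcomp Require Import all_boot all_order all_algebra.

Set Implicit Arguments.
Unset Strict Implicit.
Unset Printing Implicit Defensive.

Import Order.TTheory GRing.Theory Num.Theory.

(* A strict ranking of ties: the sets of [ties] are listed from most to least
   preferred, and the elements of one set are equally preferred. *)
Record pref_list (T : finType) := PrefList {
  ties : seq {set T};
  ties_nonempty : set0 \notin ties;
  ties_disjoint : pairwise (fun A B : {set T} => [disjoint A & B]) ties
}.

Section PrefList.
Variables (T : finType) (L : pref_list T).

Definition entries : {set T} := \bigcup_(A <- ties L) A.

Definition tie_index (x : T) : nat := find (fun A : {set T} => x \in A) (ties L).

Definition prefers (x y : T) : bool :=
  [&& x \in entries, y \in entries & tie_index x < tie_index y].

Definition indifferent (x y : T) : bool :=
  [&& x \in entries, y \in entries & tie_index x == tie_index y].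

Definition prefers_or_indifferent (x y : T) : bool :=
  prefers x y || indifferent x y.

Definition rank (x : T) : nat := 1 + #|[set y | prefers y x]|.

Definition worst_in (X : {set T}) (x : T) : bool :=
  (x \in X) && [forall y in X, ~~ prefers x y].

End PrefList.

(* The partition of the projects into the non-empty sets P_k is given by the
   surjection [lecturer] sending a project to the lecturer who offers it. *)
Record spa_st (n1 n2 n3 : nat) := SpaST {
  student_pref : 'I_n1 -> pref_list 'I_n2;
  lecturer_pref : 'I_n3 -> pref_list 'I_n1;
  lecturer : 'I_n2 -> 'I_n3;
  pcap : 'I_n2 -> nat;
  lcap : 'I_n3 -> nat;
  offers_nonempty : forall k : 'I_n3, exists j : 'I_n2, lecturer j = k;
  lecturer_entries : forall k : 'I_n3,
    entries (lecturer_pref k) =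
    [set i | [exists j, (lecturer j == k) && (j \in entries (student_pref i))]];
  pcap_gt0 : forall j : 'I_n2, 0 < pcap j;
  lcap_gt0 : forall k : 'I_n3, 0 < lcap k;
  pcap_le_lcap : forall j : 'I_n2, pcap j <= lcap (lecturer j);
  lcap_le_sum : forall k : 'I_n3, lcap k <= \sum_(j | lecturer j == k) pcap j
}.

Section Instance.
Variables (n1 n2 n3 : nat) (inst : spa_st n1 n2 n3).

Notation student := 'I_n1.
Notation project := 'I_n2.
Notation lect := 'I_n3.

Definition A_ (i : student) : {set project} := entries (student_pref inst i).

Definition acceptable (i : student) (j : project) : bool := j \in A_ i.

Definition P_ (k : lect) : {set project} := [set j | lecturer inst j == k].

Definition L_ (k : lect) : {set student} := entries (lecturer_pref inst k).

Definition Lproj (k : lect) (j : project) : {set student} :=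
  [set i in L_ k | acceptable i j].

Section Matching.
Variable M : {set student * project}.

Definition Mproj (j : project) : {set student} := [set i | (i, j) \in M].

Definition Mlect (k : lect) : {set student} :=
  [set i | [exists j in P_ k, (i, j) \in M]].

Definition unassigned (i : student) : bool := [forall j, (i, j) \notin M].

Definition is_matching : Prop :=
  [/\ forall i j, (i, j) \in M -> acceptable i j,
      forall i j j', (i, j) \in M -> (i, j') \in M -> j = j',
      forall j, #|Mproj j| <= pcap inst j
    & forall k, #|Mlect k| <= lcap inst k].

Definition p_under (j : project) : bool := #|Mproj j| < pcap inst j.
Definition p_full (j : project) : bool := #|Mproj j| == pcap inst j.
Definition l_under (k : lect) : bool := #|Mlect k| < lcap inst k.
Definition l_full (k : lect) : bool := #|Mlect k| == lcap inst k.

Definition student_blocks (i : student) (j : project) : bool :=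
  unassigned i ||
  [exists j', ((i, j') \in M) &&
              prefers_or_indifferent (student_pref inst i) j j'].

Definition beats_worst (k : lect) (i : student) (X : {set student}) : bool :=
  [exists i', worst_in (lecturer_pref inst k) X i' &&
              prefers_or_indifferent (lecturer_pref inst k) i i'].

Definition lecturer_blocks (i : student) (j : project) : bool :=
  let k := lecturer inst j in
  [|| p_under j && l_under k,
      [&& p_under j, l_full k & (i \in Mlect k) || beats_worst k i (Mlect k)]
    | p_full j && beats_worst k i (Mproj j)].

Definition blocking_pair (i : student) (j : project) : bool :=
  [&& acceptable i j, (i, j) \notin M,
      student_blocks i j & lecturer_blocks i j].

Definition super_stable_matching : Prop :=
  is_matching /\ forall i j, ~~ blocking_pair i j.

End Matching.

Definition S_ (i : student) (j : project) : {set project} :=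
  [set j' in A_ i |
     rank (student_pref inst i) j' < rank (student_pref inst i) j].

Definition T_ (i : student) (j : project) (k : lect) : {set student} :=
  [set i' in Lproj k j |
     rank (lecturer_pref inst k) i' < rank (lecturer_pref inst k) i].

Definition D_ (i : student) (k : lect) : {set student} :=
  [set i' in L_ k |
     rank (lecturer_pref inst k) i' < rank (lecturer_pref inst k) i].

Definition acc_pair := {p : student * project | acceptable p.1 p.2}.

Definition stud (q : acc_pair) : student := (val q).1.
Definition proj (q : acc_pair) : project := (val q).2.
Definition plect (q : acc_pair) : lect := lecturer inst (proj q).

Definition list_pair := {p : student * lect |
  [exists j, acceptable p.1 j && (j \in P_ p.2)]}.

Lemma acc_list_subproof (q : acc_pair) :
  [exists j, acceptable (stud q, plect q).1 j && (j \in P_ (stud q, plect q).2)].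
Proof. by apply/existsP; exists (proj q); rewrite inE eqxx andbT (valP q). Qed.

Definition acc_list (q : acc_pair) : list_pair :=
  exist _ (stud q, plect q) (acc_list_subproof q).

(* The binary variables are booleans, read as 0 and 1 in int.  The lecturer
   index k of lambda_{i,j,k} is determined by j. *)
Record solution := Solution {
  xv : acc_pair -> bool;
  alpha : project -> bool;
  beta : lect -> bool;
  gamma : project -> bool;
  eta : lect -> bool;
  delta : list_pair -> bool;
  lambda : acc_pair -> bool
}.

Local Open Scope ring_scope.

Section Feasible.
Variable s : solution.

Definition sum_stud (i : student) : int := \sum_(q | stud q == i) (xv s q)%:Z.

Definition sum_proj (j : project) : int := \sum_(q | proj q == j) (xv s q)%:Z.

Definition sum_lect (k : lect) : int :=
  \sum_(q | proj q \in P_ k) (xv s q)%:Z.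

Definition sum_S (i : student) (j : project) : int :=
  \sum_(q | (stud q == i) && (proj q \in S_ i j)) (xv s q)%:Z.

Definition sum_D (i : student) (k : lect) : int :=
  \sum_(q | (stud q \in D_ i k) && (proj q \in P_ k)) (xv s q)%:Z.

Definition sum_T (i : student) (j : project) (k : lect) : int :=
  \sum_(q | (stud q \in T_ i j k) && (proj q == j)) (xv s q)%:Z.

Definition theta (q : acc_pair) : int :=
  1 - (xv s q)%:Z - sum_S (stud q) (proj q).

Definition pair_constraints (q : acc_pair) : Prop :=
  let i := stud q in
  let j := proj q in
  let k := plect q in
  let c := (pcap inst j)%:Z in
  let d := (lcap inst k)%:Z in
  let a := (alpha s j)%:Z in
  let b := (beta s k)%:Z in
  let g := (gamma s j)%:Z in
  let e := (eta s k)%:Z in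
  let dl := (delta s (acc_list q))%:Z in
  let la := (lambda s q)%:Z in
  (c * a >= c - sum_proj j) /\
  (d * b >= d - sum_lect k) /\
  (theta q + a + b <= 2) /\
  (d * e >= (1 + sum_lect k) - d) /\
  (d * dl >= sum_lect k - sum_D i k) /\
  (theta q + a + e + dl <= 3) /\
  (c * g >= (1 + sum_proj j) - c) /\
  (c * la >= sum_proj j - sum_T i j k) /\
  (theta q + g + la <= 2).

Definition feasible : Prop :=
  [/\ forall i, sum_stud i <= 1,
      forall j, sum_proj j <= (pcap inst j)%:Z,
      forall k, sum_lect k <= (lcap inst k)%:Z
    & forall q, pair_constraints q].

Definition objective : int := \sum_i sum_stud i.

Definition matching_of : {set student * project} := [set val q | q in xv s].

End Feasible.

End Instance.

(* Main.v *)
Require Import Defs.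
From mathcomp Require Import all_boot all_order all_algebra.
From mathcomp Require Import zify.

(** Identify the variables [x] with the set [M] of pairs they select.  Every sum
    in the program then counts a part of [M]: [theta] is the truth value of
    "the student is willing to move", and [sum_lect - sum_D] and
    [sum_proj - sum_T] are positive exactly when some assignee is not strictly
    better than [s_i], that is, when [s_i] beats or ties with a worst one.
    Hence each big-M inequality forces its binary variable to 1 precisely when
    the corresponding condition in the definition of a blocking pair holds, and
    the three inequalities bounding [theta] exclude clauses (i), (ii) and (iii).
    Conversely, the truth values of these conditions form a solution. *)

Set Implicit Arguments.
Unset Strict Implicit.
Unset Printing Implicit Defensive.

Import Order.TTheory GRing.Theory Num.Theory.

Section PreferenceLists.

Variables (T : finType) (L : pref_list T).
Implicit Types (x y : T) (X : {set T}).

Lemma prefersE x y : x \in entries L -> y \in entries L ->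
  prefers L x y = (tie_index L x < tie_index L y).
Proof. by rewrite /prefers => -> ->. Qed.

Lemma prefers_or_indifferentE x y : x \in entries L -> y \in entries L ->
  prefers_or_indifferent L x y = (tie_index L x <= tie_index L y).
Proof.
move=> xL yL; rewrite /prefers_or_indifferent /indifferent prefersE // xL yL /=.
by rewrite orbC -leq_eqVlt.
Qed.

Lemma prefers_rank x y :
  prefers L x y = (x \in entries L) && (rank L x < rank L y).
Proof.
have [xL|xL] := boolP (x \in entries L); last by rewrite /prefers (negbTE xL).
rewrite /rank ltn_add2l; apply/idP/idP => [xy|].
  have /and3P[_ yL lt_xy] := xy.
  apply/proper_card/properP; split; last first.
    by exists x; rewrite !inE // prefersE ?ltnn.
  apply/subsetP => z; rewrite !inE => /and3P[zL _ zx].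
  by rewrite prefersE // (ltn_trans zx).
apply: contraLR; rewrite -leqNgt => not_xy; apply/subset_leq_card/subsetP => z.
rewrite !inE => /and3P[zL yL zy]; rewrite prefersE //.
by apply: leq_trans zy _; rewrite leqNgt -prefersE.
Qed.

Lemma exists_worst_in x X :
  x \in X -> exists2 w, worst_in L X w & tie_index L x <= tie_index L w.
Proof.
move=> xX; case: (@arg_maxnP _ x [in X] (tie_index L) xX) => w wX w_max.
exists w; last exact: w_max.
apply/andP; split=> //; apply/forall_inP => y yX.
by apply/and3P => -[_ _]; apply/negP; rewrite -leqNgt; apply: w_max.
Qed.

Lemma prefers_or_indifferent_worst x X :
  x \in entries L -> X \subset entries L ->
  [exists w, worst_in L X w && prefers_or_indifferent L x w] =
  [exists y in X, ~~ prefers L y x].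
Proof.
move=> xL /subsetP XL; apply/existsP/exists_inP => [[w]|[y yX]].
  case/andP=> /andP[wX _]; have wL := XL _ wX.
  rewrite prefers_or_indifferentE // => le_xw.
  by exists w; rewrite // prefersE // -leqNgt.
rewrite prefersE ?(XL _ yX) // -leqNgt => le_xy.
have [w w_worst le_yw] := exists_worst_in yX.
have wL : w \in entries L by case/andP: w_worst => /XL.
exists w; rewrite w_worst prefers_or_indifferentE //=; exact: leq_trans le_yw.
Qed.

End PreferenceLists.

Section Instance.

Variables (n1 n2 n3 : nat) (inst : spa_st n1 n2 n3).
Implicit Types (i : 'I_n1) (j : 'I_n2) (k : 'I_n3) (X : {set 'I_n1}).

Lemma mem_S i j j' : (j' \in S_ inst i j) = prefers (student_pref inst i) j' j.
Proof. by rewrite inE prefers_rank. Qed.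

Lemma mem_D i k i' :
  (i' \in D_ inst i k) = prefers (lecturer_pref inst k) i' i.
Proof. by rewrite inE prefers_rank. Qed.

Lemma mem_T i j k i' :
  (i' \in T_ inst i j k) = acceptable inst i' j && (i' \in D_ inst i k).
Proof. by rewrite !inE andbAC andbC. Qed.

Lemma acceptable_L i j : acceptable inst i j -> i \in L_ inst (lecturer inst j).
Proof.
move=> ij; rewrite /L_ lecturer_entries inE; apply/existsP; exists j.
by rewrite eqxx.
Qed.

Lemma beats_worstE k i X : i \in L_ inst k -> X \subset L_ inst k ->
  beats_worst inst k i X = ~~ (X \subset D_ inst i k).
Proof.
move=> iL XL; rewrite /beats_worst prefers_or_indifferent_worst //.
apply/exists_inP/subsetPn => -[i' i'X i'_not_better]; exists i' => //.
  by rewrite mem_D.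
by rewrite -mem_D.
Qed.

Section PairSet.

Variable M : {set 'I_n1 * 'I_n2}.

Definition Mstud i : {set 'I_n2} := [set j | (i, j) \in M].

Lemma card_Mstud_le1P :
  (forall i, #|Mstud i| <= 1) <->
  (forall i j j', (i, j) \in M -> (i, j') \in M -> j = j').
Proof.
split=> [le1 i j j' ij ij'|M_fun i].
  by apply: (card_le1_eqP (le1 i)); rewrite inE.
by apply/card_le1_eqP => j j'; rewrite !inE => ij ij'; apply: M_fun ij' ij.
Qed.

Lemma card_pairs_stud i (Y : {set 'I_n2}) :
  #|[set p in M | (p.1 == i) && (p.2 \in Y)]| = #|Mstud i :&: Y|.
Proof.
rewrite -(on_card_preimset (f := pair i)).
  by apply: eq_card => j; rewrite !inE eqxx.
by exists snd => // -[i' j]; rewrite inE => /and3P[_ /eqP/= -> _].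
Qed.

Lemma card_pairs_proj j X :
  #|[set p in M | (p.1 \in X) && (p.2 == j)]| = #|Mproj M j :&: X|.
Proof.
rewrite -(on_card_preimset (f := pair^~ j)).
  by apply: eq_card => i; rewrite !inE eqxx andbT.
by exists fst => // -[i j']; rewrite inE => /and3P[_ _ /eqP/= ->].
Qed.

Hypothesis M_acc : forall i j, (i, j) \in M -> acceptable inst i j.

Lemma Mproj_sub_L j : Mproj M j \subset L_ inst (lecturer inst j).
Proof. by apply/subsetP => i; rewrite inE => /M_acc/acceptable_L. Qed.

Lemma Mlect_sub_L k : Mlect inst M k \subset L_ inst k.
Proof.
apply/subsetP => i; rewrite inE => /exists_inP[j].
by rewrite inE => /eqP<- /M_acc/acceptable_L.
Qed.

Lemma MprojI_T i j k : Mproj M j :&: T_ inst i j k = Mproj M j :&: D_ inst i k.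
Proof.
apply/setP => i'; rewrite !in_setI mem_T.
by have [|//] := boolP (i' \in Mproj M j); rewrite inE => /M_acc->.
Qed.

(* A current assignee of the lecturer weakly beats a worst one, so the first
   alternative of clause (ii) is subsumed by the second. *)
Lemma lecturer_blocksE i j (k := lecturer inst j) : acceptable inst i j ->
  lecturer_blocks inst M i j =
  [|| p_under inst M j && l_under inst M k,
      [&& p_under inst M j, l_full inst M k
        & beats_worst inst k i (Mlect inst M k)]
    | p_full inst M j && beats_worst inst k i (Mproj M j)].
Proof.
move=> ij; rewrite /lecturer_blocks -/k.
have [iM|//] := boolP (i \in Mlect inst M k).
suff -> : beats_worst inst k i (Mlect inst M k) by [].
rewrite beats_worstE ?acceptable_L ?Mlect_sub_L //.
by apply/subsetPn; exists i; rewrite // inE ltnn andbF.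
Qed.

Hypothesis Mstud_le1 : forall i, #|Mstud i| <= 1.

Lemma card_pairs_lect k X :
  #|[set p in M | (p.1 \in X) && (p.2 \in P_ inst k)]|
    = #|Mlect inst M k :&: X|.
Proof.
rewrite -(card_in_imset (f := fst)); last first.
  move=> [i j] [i' j'] /=; rewrite !inE /= => /andP[ij _] /andP[ij' _] i_i'.
  by subst i'; rewrite (card_Mstud_le1P.1 Mstud_le1 _ _ _ ij ij').
apply: eq_card => i; apply/imsetP/setIP => [[[i' j]]|[]].
  rewrite inE /= => /and3P[ij iX jk] ->; split=> //.
  by rewrite inE; apply/exists_inP; exists j.
rewrite inE => /exists_inP[j jk ij] iX.
by exists (i, j); rewrite // inE ij iX jk.
Qed.

Lemma student_blocksE i j : acceptable inst i j ->
  student_blocks inst M i j = (#|Mstud i :&: S_ inst i j| == 0).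
Proof.
move=> jA; rewrite /student_blocks cards_eq0 setI_eq0 disjoint_subset.
have [/forallP un|/forallPn[j1 /negPn ij1]] := boolP (unassigned M i).
  by apply/esym/subsetP => j'; rewrite inE (negbTE (un j')).
have Mstud1 j' : (i, j') \in M -> j' = j1.
  by move=> ij'; apply: card_Mstud_le1P.1 ij' ij1.
have j1A : j1 \in A_ inst i := M_acc ij1.
transitivity (j1 \notin S_ inst i j).
  rewrite mem_S prefersE // -leqNgt -prefers_or_indifferentE //.
  apply/existsP/idP => [[j' /andP[/Mstud1->]] //|j_j1].
  by exists j1; rewrite ij1.
apply/idP/subsetP => [j1_notS j'|sub]; last by apply: sub; rewrite inE.
by rewrite inE => /Mstud1->.
Qed.

End PairSet.

Definition willing (M : {set 'I_n1 * 'I_n2}) i j : bool :=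
  ((i, j) \notin M) && student_blocks inst M i j.

Local Open Scope ring_scope.

Lemma le_bigM (R : realDomainType) (m d : R) (b : bool) :
  m <= d -> (m <= d * b%:R) = ((0 < m) ==> b).
Proof.
by case: b => m_le_d; rewrite ?mulr1 ?mulr0 ?implybT // implybF leNgt.
Qed.

Lemma bigM_undersubscribed (n c : nat) (b : bool) :
  (c%:Z - n%:Z <= c%:Z * b%:Z) = ((n < c)%N ==> b).
Proof. by rewrite -(natz b) le_bigM ?subr_gt0 // gerBl. Qed.

Lemma bigM_full (n c : nat) (b : bool) : (0 < c)%N -> (n <= c)%N ->
  (1 + n%:Z - c%:Z <= c%:Z * b%:Z) = ((n == c) ==> b).
Proof.
move=> c_gt0 n_le_c; rewrite -(natz b) le_bigM ?subr_gt0; last by lia.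
by rewrite ltz1D lez_nat eqn_leq n_le_c.
Qed.

Lemma bigM_not_subset (T : finType) (X Y : {set T}) (c : nat) (b : bool) :
  (#|X| <= c)%N ->
  (#|X|%:Z - #|X :&: Y|%:Z <= c%:Z * b%:Z) = (~~ (X \subset Y) ==> b).
Proof.
move=> X_le_c; rewrite -(natz b) le_bigM; last by lia.
by rewrite subr_gt0 ltz_nat ltnNge (sameP setIidPl eqP) eqEcard subsetIl.
Qed.

Lemma sum3_bool_le2 (a b c : bool) :
  (a%:Z + b%:Z + c%:Z <= 2) = ~~ [&& a, b & c].
Proof. by case: a; case: b; case: c. Qed.

Lemma sum4_bool_le3 (a b c d : bool) :
  (a%:Z + b%:Z + c%:Z + d%:Z <= 3) = ~~ [&& a, b, c & d].
Proof. by case: a; case: b; case: c; case: d. Qed.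

Section Solution.

Variable s : solution inst.
Local Notation M := (matching_of s).

Lemma mem_matching_of (q : acc_pair inst) : (val q \in M) = xv s q.
Proof. by rewrite mem_imset //; apply: val_inj. Qed.

Lemma matching_of_acceptable i j : (i, j) \in M -> acceptable inst i j.
Proof. by case/imsetP=> q _ ij; have := valP q; rewrite -ij. Qed.

Lemma sum_xvE (P : pred ('I_n1 * 'I_n2)) :
  \sum_(q : acc_pair inst | P (val q)) (xv s q)%:Z = #|[set p in M | P p]|%:Z.
Proof.
have -> : [set p in M | P p] = val @: [set q | P (val q) & xv s q].
  apply/setP => p; rewrite inE; apply/andP/imsetP => [[/imsetP[q qs ->] Pq]|].
    by exists q; rewrite // inE Pq.
  by case=> q; rewrite inE => /andP[Pq qs] ->; rewrite mem_matching_of.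
rewrite card_imset; last exact: val_inj.
rewrite -sum1dep_card big_mkcondr (big_morph Posz PoszD (erefl _)).
by apply: eq_bigr => q _; case: (xv s q).
Qed.

Lemma objectiveE : objective s = #|M|%:Z.
Proof.
have -> : objective s = \sum_q (xv s q)%:Z.
  by rewrite (partition_big (@stud _ _ _ inst) xpredT).
rewrite (sum_xvE xpredT); congr (Posz #|pred_of_set _|).
by apply/setP => p; rewrite inE andbT.
Qed.

Lemma sum_SE i j : sum_S s i j = #|Mstud M i :&: S_ inst i j|%:Z.
Proof. by rewrite -card_pairs_stud -sum_xvE. Qed.

Lemma sum_studE i : sum_stud s i = #|Mstud M i|%:Z.
Proof.
rewrite -[Mstud M i]setIT -card_pairs_stud -sum_xvE.
by apply: eq_bigl => q; rewrite in_setT andbT.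
Qed.

Lemma sum_TE i j k : sum_T s i j k = #|Mproj M j :&: D_ inst i k|%:Z.
Proof.
by rewrite -(MprojI_T matching_of_acceptable) -card_pairs_proj -sum_xvE.
Qed.

Lemma sum_projE j : sum_proj s j = #|Mproj M j|%:Z.
Proof.
rewrite -[Mproj M j]setIT -card_pairs_proj -sum_xvE.
by apply: eq_bigl => q; rewrite in_setT.
Qed.

Section Functional.

Hypothesis Mstud_le1 : forall i, (#|Mstud M i| <= 1)%N.

Lemma sum_DE i k : sum_D s i k = #|Mlect inst M k :&: D_ inst i k|%:Z.
Proof. by rewrite -card_pairs_lect // -sum_xvE. Qed.

Lemma sum_lectE k : sum_lect s k = #|Mlect inst M k|%:Z.
Proof.
rewrite -[Mlect _ M k]setIT -card_pairs_lect // -sum_xvE.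
by apply: eq_bigl => q; rewrite in_setT.
Qed.

Lemma thetaE q : theta s q = (willing M (stud q) (proj q))%:Z.
Proof.
have val_q : val q = (stud q, proj q) := surjective_pairing _.
rewrite /theta /willing -mem_matching_of val_q sum_SE.
rewrite (student_blocksE matching_of_acceptable) //; last exact: (valP q).
set i := stud q; set j := proj q.
have [ij|ij] := boolP ((i, j) \in M); last first.
  have := subset_leq_card (subsetIl (Mstud M i) (S_ inst i j)).
  have := Mstud_le1 i; lia.
suff -> : Mstud M i :&: S_ inst i j = set0 by rewrite cards0.
apply/setP => j'; rewrite !inE; apply/andP => -[ij' /andP[_]].
by rewrite ((card_Mstud_le1P M).1 Mstud_le1 _ _ _ ij ij') ltnn.
Qed.

End Functional.

Lemma is_matchingP :
  is_matching inst M <->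
  [/\ forall i, sum_stud s i <= 1,
      forall j, sum_proj s j <= (pcap inst j)%:Z
    & forall k, sum_lect s k <= (lcap inst k)%:Z].
Proof.
split=> [[_ M_fun M_pcap M_lcap]|[s_stud s_proj s_lect]].
  have Mstud_le1 := (card_Mstud_le1P M).2 M_fun.
  by split=> [i|j|k]; rewrite ?sum_studE ?sum_projE ?sum_lectE // lez_nat.
have Mstud_le1 i : (#|Mstud M i| <= 1)%N by rewrite -lez_nat -sum_studE.
split=> [||j|k]; first exact: matching_of_acceptable.
- exact/card_Mstud_le1P.
- by rewrite -lez_nat -sum_projE.
- by rewrite -lez_nat -sum_lectE.
Qed.

Definition indicators_forced q : bool :=
  let: (i, j, k) := (stud q, proj q, plect q) in
  [&& p_under inst M j ==> alpha s j,
      l_under inst M k ==> beta s k,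
      l_full inst M k ==> eta s k,
      beats_worst inst k i (Mlect inst M k) ==> delta s (acc_list q),
      p_full inst M j ==> gamma s j
    & beats_worst inst k i (Mproj M j) ==> lambda s q].

Definition indicators_block q : bool :=
  let: (j, k) := (proj q, plect q) in
  [|| alpha s j && beta s k,
      [&& alpha s j, eta s k & delta s (acc_list q)]
    | gamma s j && lambda s q].

Lemma pair_constraintsP q : is_matching inst M ->
  pair_constraints s q <->
  indicators_forced q && ~~ (willing M (stud q) (proj q) && indicators_block q).
Proof.
move=> [_ M_fun M_pcap M_lcap].
have Mstud_le1 := (card_Mstud_le1P M).2 M_fun.
have iL : stud q \in L_ inst (plect q) by apply: acceptable_L (valP q).
have MjL := Mproj_sub_L matching_of_acceptable (proj q).
have MkL := Mlect_sub_L matching_of_acceptable (plect q).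
rewrite /indicators_forced /indicators_block !beats_worstE //.
rewrite /pair_constraints thetaE // sum_TE sum_DE // sum_projE sum_lectE //.
rewrite !sum3_bool_le2 !sum4_bool_le3 !bigM_undersubscribed.
rewrite !bigM_full ?bigM_not_subset ?pcap_gt0 ?lcap_gt0 //.
rewrite /p_under /p_full /l_under /l_full !andb_orr !negb_or.
split=> [[-> [-> [-> [-> [-> [-> [-> [->]]]]]]]] //|].
by case/andP=> /and5P[-> -> -> -> /andP[-> ->]] /and3P[-> -> ->].
Qed.

Lemma feasibleP :
  feasible s <->
  is_matching inst M /\
  forall q, indicators_forced q &&
    ~~ (willing M (stud q) (proj q) && indicators_block q).
Proof.
split=> [[s_stud s_proj s_lect s_pair]|[M_matching s_ind]].
  have M_matching : is_matching inst M by apply/is_matchingP.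
  by split=> // q; apply/pair_constraintsP.
have [s_stud s_proj s_lect] := (is_matchingP.1 M_matching).
by split=> // q; apply/pair_constraintsP.
Qed.

Lemma lecturer_blocks_indicated q : indicators_forced q ->
  lecturer_blocks inst M (stud q) (proj q) -> indicators_block q.
Proof.
rewrite (lecturer_blocksE matching_of_acceptable) ?(valP q) //.
case/and5P=> /implyP force_alpha /implyP force_beta /implyP force_eta.
move=> /implyP force_delta /andP[/implyP force_gamma /implyP force_lambda].
rewrite /indicators_block.
case/or3P=> [/andP[/force_alpha-> /force_beta->] //||].
  by case/and3P=> /force_alpha-> /force_eta-> /force_delta->; rewrite orbT.
by case/andP=> /force_gamma-> /force_lambda->; rewrite !orbT.
Qed.

Lemma feasible_super_stable : feasible s -> super_stable_matching inst M.
Proof.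
move=> /feasibleP[M_matching s_ind]; split=> // i j.
apply/negP => /and4P[ij ijM i_blocks l_blocks].
have /andP[forced /negP[]] := s_ind (exist _ (i, j) ij).
by rewrite /willing ijM i_blocks lecturer_blocks_indicated.
Qed.

End Solution.

Definition solution_of (M : {set 'I_n1 * 'I_n2}) : solution inst :=
  {| xv q := val q \in M;
     alpha j := p_under inst M j;
     beta k := l_under inst M k;
     gamma j := p_full inst M j;
     eta k := l_full inst M k;
     delta r := let: (i, k) := val r in beats_worst inst k i (Mlect inst M k);
     lambda q := beats_worst inst (plect q) (stud q) (Mproj M (proj q)) |}.

Lemma matching_of_solution_of (M : {set 'I_n1 * 'I_n2}) :
  (forall i j, (i, j) \in M -> acceptable inst i j) ->
  matching_of (solution_of M) = M.
Proof.
move=> M_acc; apply/setP => -[i j]; apply/imsetP/idP => [[q qM ->] //|ijM].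
by exists (exist _ (i, j) (M_acc i j ijM)).
Qed.

Lemma solution_of_feasible (M : {set 'I_n1 * 'I_n2}) :
  super_stable_matching inst M -> feasible (solution_of M).
Proof.
case=> M_matching M_stable; have [M_acc _ _ _] := M_matching.
apply/feasibleP; rewrite matching_of_solution_of //; split=> // q.
rewrite /indicators_forced matching_of_solution_of //= !implybb /=.
have := M_stable (stud q) (proj q).
by rewrite /blocking_pair (valP q) /willing -andbA lecturer_blocksE ?(valP q).
Qed.

End Instance.

Theorem theorem4 (n1 n2 n3 : nat) (inst : spa_st n1 n2 n3) :
  (forall s : solution inst, feasible s ->
     super_stable_matching inst (matching_of s) /\
     Posz #|matching_of s| = objective s) /\
  (forall M : {set 'I_n1 * 'I_n2}, super_stable_matching inst M ->
     exists s : solution inst,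
       [/\ feasible s,
           forall q : acc_pair inst, xv s q = (val q \in M)
         & objective s = Posz #|M|]).
Proof.
split=> [s s_feasible|M M_stable].
  by split; [apply: feasible_super_stable | rewrite objectiveE].
have [[M_acc _ _ _] _] := M_stable.
exists (solution_of inst M); split=> //; first exact: solution_of_feasible.
by rewrite objectiveE matching_of_solution_of.
Qed.
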